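(* Fix $k\ge4$. Let $p\ge q$ be positive integers with $p-q\le 1$ (so $p+q=m-1$ with $|p-q|\le1$ for $m=p+q+1$). Let $H=C_2(p-1,q-1,1)$ and $G=C_3(p,q)$. Then $\rho(H)<\rho(G)$.
   Context: A $k$-graph is a simple $k$-uniform hypergraph; $\rho$ denotes the spectral radius of the adjacency tensor (order $k$, entries $1/(k-1)!$ at index tuples forming an edge, $0$ otherwise; maximal modulus of eigenvalues $\lambda$ with $\mathcal{A}x=\lambda x^{[k-1]}$, $x\ne0$). Joining distinct vertices $a,b$ by a loose path of length $n\ge1$ means adding new edges $f_1,\dots,f_n$ with $a\in f_1$, $b\in f_n$, $|f_i\cap f_{i+1}|=1$, $f_i\cap f_j=\emptyset$ for $|i-j|\ge2$, and all vertices other than $a,b$ new; joining by a path of length $0$ means identifying $a$ and $b$. $C_2(n_1,n_2,n_3)$: take disjoint $k$-sets $e',e''$ with distinct $u_1,u_2,u_3\in e'$ and distinct $v_1,v_2,v_3\in e''$, and join $u_i,v_i$ by a loose path of length $n_i$ ($i=1,2,3$). $C_3(n_1,n_2)$: take a $k$-set $e$ with distinct $u_1,u_2,v_1,v_2\in e$ and join $u_1,u_2$ by a loose path of length $n_1$ and $v_1,v_2$ by one of length $n_2$. *)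

(* Defs.v *)
From HB Require Import structures.
From mathcomp Require Import all_boot all_order all_algebra.
From mathcomp Require Import all_classical reals.
From mathcomp Require Import complex.

Set Implicit Arguments.
Unset Strict Implicit.
Unset Printing Implicit Defensive.

Import Order.TTheory GRing.Theory Num.Theory.

Local Open Scope ring_scope.

(* Simple hypergraphs *)

Record hypergraph := Hypergraph { vertex :> finType; edges : {set {set vertex}} }.

(* A k-graph is a hypergraph H such that uniform k H. *)
Definition uniform (k : nat) (H : hypergraph) : Prop :=
  forall e, e \in edges H -> #|e| = k.

(* Tensors of order k over the complex numbers, with indices in a finite type,
   and their spectral radius *)

Section Tensor.
Variables (R : realType) (k : nat) (V : finType).

Definition tensor := k.-tuple V -> R[i].

(* (A x)_i is the sum of a_(i, i_2, ..., i_k) x_(i_2) ... x_(i_k) over all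
   i_2, ..., i_k: the sum runs over the index k-tuples whose head is i. *)
Definition tensor_apply (A : tensor) (x : {ffun V -> R[i]}) (i : V) : R[i] :=
  \sum_(t : k.-tuple V | ohead t == Some i) A t * \prod_(j <- behead t) x j.

Definition eigenvalue_tensor (A : tensor) (l : R[i]) : Prop :=
  exists2 x : {ffun V -> R[i]}, x != 0 &
    forall i, tensor_apply A x i = l * x i ^+ k.-1.

(* The set of moduli has a maximum as soon as V is nonempty and 1 < k, so that
   its supremum is the maximal modulus. *)
Definition spectral_radius_tensor (A : tensor) : R :=
  sup [set r : R | exists2 l, eigenvalue_tensor A l & `|l| = (r%:C)%C]%classic.

End Tensor.

(* For uniform k H, a tuple t with [set x in t] an edge has distinct entries. *)
Definition adjacency_tensor (R : realType) (k : nat) (H : hypergraph) :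
    tensor R k H :=
  fun t => if [set x in t] \in edges H then (k.-1)`!%:R^-1 else 0.

Definition rho (R : realType) (k : nat) (H : hypergraph) : R :=
  spectral_radius_tensor (@adjacency_tensor R k H).

(* Identification of the vertices a and b: they become the new vertex None,
   which is the value of insub at a and at b. *)
Definition identify (H : hypergraph) (a b : H) : hypergraph :=
  @Hypergraph (option {x : H | x \notin [:: a; b]})
    [set [set insub x | x in e] | e : {set H} in edges H].

(* The vertices of a loose path with n edges of size k from a to b are numbered
   from 0 to N = n * (k - 1) along the path: a has number 0, b has number N and
   the N - 1 others are new.  The i-th edge consists of the k consecutive
   vertices numbered from i * (k - 1) to (i + 1) * (k - 1), for i < n. *)
Definition path_vertex (H : hypergraph) (a b : H) (N j : nat) : H + 'I_N.-1 :=
  if j == 0%N then inl a else if insub j.-1 is Some i then inr i else inl b.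

Definition path_edge (H : hypergraph) (a b : H) (k n : nat) (i : 'I_n) :
    {set H + 'I_(n * k.-1).-1} :=
  [set path_vertex a b (n * k.-1) (i * k.-1 + j)%N | j : 'I_k].

Definition add_path (k : nat) (H : hypergraph) (a b : H) (n : nat) :
    hypergraph :=
  @Hypergraph (H + 'I_(n * k.-1).-1)%type
    ([set [set inl x | x in e] | e : {set H} in edges H] :|:
     [set path_edge a b k i | i : 'I_n]).

Definition join (k : nat) (H : hypergraph) (a b : H) (n : nat) : hypergraph :=
  if n is 0 then identify a b else add_path k a b n.

(* The map sending a vertex of H to the corresponding vertex of the join. *)
Definition join_emb (k : nat) (H : hypergraph) (a b : H) (n : nat) :
    H -> join k a b n :=
  match n return H -> join k a b n with
  | 0 => fun x => insub x
  | n'.+1 => fun x => inl x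
  end.

Definition two_edges (k : nat) : hypergraph :=
  @Hypergraph ('I_k + 'I_k)%type
    [set [set inl x | x in [set: 'I_k]]; [set inr x | x in [set: 'I_k]]].

Definition one_edge (k : nat) : hypergraph :=
  @Hypergraph 'I_k [set [set: 'I_k]].

(* C2 and C3 take as arguments the vertices chosen in the initial edges; these
   choices are immaterial up to isomorphism, provided that the u's (resp. the
   v's, resp. all of u1, u2, v1, v2) are distinct. *)
Definition C2 (k : nat) (u1 u2 u3 v1 v2 v3 : 'I_k) (n1 n2 n3 : nat) :
    hypergraph :=
  let f0 (x : 'I_k + 'I_k) : two_edges k := x in
  let f1 x := join_emb k (f0 (inl u1)) (f0 (inr v1)) n1 (f0 x) in
  let f2 x := join_emb k (f1 (inl u2)) (f1 (inr v2)) n2 (f1 x) in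
  join k (f2 (inl u3)) (f2 (inr v3)) n3.

Definition C3 (k : nat) (u1 u2 v1 v2 : 'I_k) (n1 n2 : nat) : hypergraph :=
  let f0 (x : 'I_k) : one_edge k := x in
  let f1 x := join_emb k (f0 u1) (f0 u2) n1 (f0 x) in
  join k (f1 v1) (f1 v2) n2.

Section Uniform.
Variable k : nat.
Hypothesis k_gt1 : (1 < k)%N.

Definition separated (H : hypergraph) (a b : H) : Prop :=
  a != b /\ forall e, e \in edges H -> ~~ ((a \in e) && (b \in e)).

Lemma insub_notin_inj (H : hypergraph) (a b x y : H) :
  insub x = insub y :> option {x : H | x \notin [:: a; b]} ->
  x = y \/ (x \in [:: a; b]) && (y \in [:: a; b]).
Proof.
case: insubP => [u Pu <-|]; case: insubP => [w Pw <-|] //.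
- by move=> [->]; left.
- by rewrite !negbK => -> ->; right.
Qed.

Lemma identify_uniform (H : hypergraph) (a b : H) :
  uniform k H -> separated a b -> uniform k (identify a b).
Proof.
move=> Hk [ab sab] e /imsetP[f Hf ->]; rewrite card_in_imset ?Hk // => x y xf yf.
move=> /insub_notin_inj[//|/andP[]].
have:= sab f Hf; rewrite !inE.
by move=> N /orP[/eqP ex|/eqP ex] /orP[/eqP ey|/eqP ey]; subst => //;
  rewrite xf yf in N.
Qed.

Lemma path_vertex_inj (H : hypergraph) (a b : H) (N i j : nat) : a != b ->
  (i <= N)%N -> (j <= N)%N ->
  path_vertex a b N i = path_vertex a b N j -> i = j.
Proof.
move=> ab iN jN; rewrite /path_vertex.
have last m : (m <= N)%N -> m != 0%N -> ~~ (m.-1 < N.-1)%N -> m = N.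
  move=> mN m0; rewrite -leqNgt => Nm; apply/anti_leq; rewrite mN /=.
  by move: m0 Nm {mN}; case: m => // m _; case: N {iN jN}.
have ba : b != a by rewrite eq_sym.
case: eqVneq => [->|i0]; case: eqVneq => [->|j0] //.
- by case: insubP => // _ [/eqP]; rewrite (negPf ab).
- by case: insubP => // _ [/eqP]; rewrite (negPf ba).
- case: insubP => [u _ Eu|Ni]; case: insubP => [w _ Ew|Nj] //.
    by move=> [uw]; move: i0 j0 Eu; rewrite uw Ew; case: i j {iN jN Ew} => [|i] [|j] //= _ _ ->.
  by rewrite (last i) // (last j).
Qed.

Lemma add_path_uniform (H : hypergraph) (a b : H) (n : nat) :
  uniform k H -> a != b -> uniform k (add_path k a b n).
Proof.
move=> Hk ab e /setUP[] /imsetP[f Hf ->].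
  by rewrite card_imset ?Hk //; apply: inl_inj.
rewrite card_in_imset ?card_ord // => x y _ _ E.
have bound (j : 'I_k) : (f * k.-1 + j <= n * k.-1)%N.
  apply: (@leq_trans (f.+1 * k.-1)); last by rewrite leq_mul2r ltn_ord orbT.
  by rewrite mulSn addnC leq_add2r -ltnS prednK ?ltn_ord // ltnW.
apply: val_inj; apply: (@addnI (f * k.-1)%N).
exact: (path_vertex_inj ab (bound x) (bound y) E).
Qed.

Lemma join_uniform (H : hypergraph) (a b : H) (n : nat) :
  uniform k H -> (if n is 0 then separated a b else a != b) ->
  uniform k (join k a b n).
Proof.
by case: n => [|n]; [apply: identify_uniform | apply: add_path_uniform].
Qed.

Lemma join_emb_neq (H : hypergraph) (a b x y : H) (n : nat) :
  x != y -> x \notin [:: a; b] -> join_emb k a b n x != join_emb k a b n y.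
Proof.
move=> xy xab; apply/eqP; case: n => [/insub_notin_inj[/eqP|]|n [/eqP]] /=.
- by rewrite (negPf xy).
- by rewrite (negPf xab).
- by rewrite (negPf xy).
Qed.

Lemma mem_path_edge (H : hypergraph) (a b x : H) (n : nat) (i : 'I_n) :
  inl x \in path_edge a b k i -> x \in [:: a; b].
Proof.
case/imsetP=> j _; rewrite /path_vertex.
case: ifP => [_ [->]|_]; first by rewrite !inE eqxx.
by case: insubP => // _ [->]; rewrite !inE eqxx orbT.
Qed.

Lemma join_emb_separated (H : hypergraph) (a b x y : H) (n : nat) :
  separated x y -> x \notin [:: a; b] -> y \notin [:: a; b] ->
  separated (join_emb k a b n x) (join_emb k a b n y).
Proof.
move=> [xy sxy] xab yab; split; first exact: join_emb_neq.
case: n => [|n] e /=.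
  case/imsetP=> f Hf ->; apply/negP=> /andP[/imsetP[x' x'f Ex] /imsetP[y' y'f Ey]].
  have/negP := sxy f Hf; apply.
  have [->|] := insub_notin_inj Ex; last by rewrite (negPf xab).
  have [->|] := insub_notin_inj Ey; last by rewrite (negPf yab).
  by rewrite x'f y'f.
case/setUP=> /imsetP[f Hf ->].
  by rewrite !mem_imset ?sxy //; apply: inl_inj.
by apply/negP=> /andP[/mem_path_edge]; rewrite (negPf xab).
Qed.

Lemma two_edges_uniform : uniform k (two_edges k).
Proof.
move=> e /set2P[] ->; rewrite card_imset ?cardsT ?card_ord //.
  exact: inl_inj.
exact: inr_inj.
Qed.

Lemma two_edges_separated (x y : 'I_k) :
  @separated (two_edges k) (inl x) (inr y).
Proof.
split=> // e /set2P[] ->; apply/negP=> /andP[].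
  by move=> _ /imsetP[].
by move=> /imsetP[].
Qed.

Lemma one_edge_uniform : uniform k (one_edge k).
Proof. by move=> e /set1P ->; rewrite cardsT card_ord. Qed.

End Uniform.

Lemma C2_uniform (k : nat) (u1 u2 u3 v1 v2 v3 : 'I_k) (n1 n2 n3 : nat) :
  uniq [:: u1; u2; u3] -> uniq [:: v1; v2; v3] ->
  uniform k (C2 u1 u2 u3 v1 v2 v3 n1 n2 n3).
Proof.
rewrite /= !inE !negb_or => /andP[/andP[u12 u13] /andP[u23 _]].
move=> /andP[/andP[v12 v13] /andP[v23 _]].
have k_gt1 : (1 < k)%N.
  case: k u1 u2 u3 v1 v2 v3 u12 {u13 u23 v12 v13 v23} => [|[|k']] // x y.
    by case: x.
  by rewrite !ord1.
have sep (H : hypergraph) (a b : H) (n : nat) : separated a b ->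
    if n is 0 then separated a b else a != b by case: n => // n [].
have eq_inl (x y : 'I_k) : (@inl _ 'I_k x == inl y) = (x == y) by [].
have eq_inr (x y : 'I_k) : (@inr 'I_k _ x == inr y) = (x == y) by [].
have s1 := two_edges_separated u1 v1.
have lu x y (z : 'I_k) : x != y -> (inl y : two_edges k) \notin [:: inl x; inr z].
  by move=> xy; apply/negP; rewrite !inE => /orP[/eqP[E]|//]; rewrite E eqxx in xy.
have rv x y (z : 'I_k) : x != y -> (inr y : two_edges k) \notin [:: inl z; inr x].
  by move=> xy; apply/negP; rewrite !inE => /orP[//|/eqP[E]]; rewrite E eqxx in xy.
have emb2 x y : u1 != x -> v1 != y -> separated
    (join_emb k (inl u1 : two_edges k) (inr v1) n1 (inl x))
    (join_emb k (inl u1 : two_edges k) (inr v1) n1 (inr y)).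
  by move=> ? ?; apply: join_emb_separated; [exact: two_edges_separated | exact: lu | exact: rv].
have nlr x (y : 'I_k) : (inl x : two_edges k) != inr y by [].
rewrite /C2; do 3?[apply: join_uniform => //]; try exact: two_edges_uniform;
  apply: sep => //; first exact: emb2.
apply: join_emb_separated; first exact: emb2.
- by rewrite !inE negb_or; apply/andP; split; apply: join_emb_neq;
    rewrite ?eq_inl 1?eq_sym //; apply: lu.
- by rewrite !inE negb_or; apply/andP; split; apply: join_emb_neq;
    rewrite ?eq_inr 1?eq_sym //; apply: rv.
Qed.

Lemma C3_uniform (k : nat) (u1 u2 v1 v2 : 'I_k) (n1 n2 : nat) :
  (0 < n1)%N -> (0 < n2)%N -> uniq [:: u1; u2; v1; v2] ->
  uniform k (C3 u1 u2 v1 v2 n1 n2).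
Proof.
case: n1 n2 => [|n1] [|n2] // _ _.
rewrite /= !inE !negb_or => /and3P[/and3P[u12 _ _] _ /andP[v12 _]].
have k_gt1 : (1 < k)%N.
  case: k u1 u2 v1 v2 u12 v12 => [|[|k']] // x y.
    by case: x.
  by rewrite !ord1.
by do 2?[apply: add_path_uniform => //]; apply: one_edge_uniform.
Qed.

(* Main.v *)
(* Put y_v = w_v^(1/k). If every edge e has prod_(v in e) y_v = mu z_e, then y is
   an eigenvector for mu exactly when w_v is the sum of the z_e over e containing
   v, and a positive y with "<=" in place of "=" bounds every eigenvalue by mu.
   With mu^k = ((1+c^2)/c)^2, the condition on the edges of a loose path of
   length n is (z_(i-1) + z_i) (z_i + z_(i+1)) = mu^k z_i^2, which is solved by
   z_i proportional to cosh ((n+1-2i) log c) + cosh (log c); if the edges at the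
   two ends have z = 1, the end vertices get the weight
   t_n = (1+c^2) (1+c^n) / (1+c^(n+2)), also for n = 0. Hence mu is the spectral
   radius of C3(p,q) if t_p t_q = (1+c^2)/c, and of C2(p-1,q-1,1) if
   t_(p-1) t_(q-1) t_1 = ((1+c^2)/c)^2. The second equation has a root d in (c,1)
   when c in (0,1) solves the first one, and (1+c^2)/c decreases on (0,1). *)
Require Import Defs.
From mathcomp Require Import all_boot all_order all_algebra.
From mathcomp Require Import all_classical reals.
From mathcomp Require Import complex exp.
From mathcomp Require Import ring lra zify.
Import Order.TTheory GRing.Theory Num.Theory.
Local Open Scope ring_scope.

Set Implicit Arguments.
Unset Strict Implicit.
Unset Printing Implicit Defensive.

(** * Bounds on the spectral radius *)

Lemma ohead_cons (T : Type) (x : T) (s : seq T) :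
  ohead s = Some x -> s = x :: behead s.
Proof. by case: s => // y s [->]. Qed.

(** Removing the head leaves an arbitrary ordering of [e :\ i]. This count cancels the entries
    1/(k-1)! of the adjacency tensor. *)
Lemma card_tuples_head_set (V : finType) (k : nat) (i : V) (e : {set V}) :
  i \in e -> #|e| = k.+1 ->
  #|[set t : k.+1.-tuple V | (ohead t == Some i) && ([set x in t] == e)]| = k`!.
Proof.
move=> ie ek.
have eik : #|e :\ i| = k by have := cardsD1 i e; rewrite ie ek => -[].
transitivity #|[set s : k.-tuple V | all (mem (e :\ i)) s & uniq s]|; last first.
  by rewrite card_uniq_tuples eik ffactnn.
pose h (s : k.-tuple V) := [tuple of i :: s].
have hinj : injective h by move=> s s' [/val_inj].
rewrite -(card_imset _ hinj); congr #|pred_of_set _|; apply/setP => t.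
rewrite inE; apply/andP/imsetP => [[/eqP ht /eqP te]|[s]].
  exists (behead_tuple t).
    have tE := ohead_cons ht.
    have : uniq t.
      by apply/card_uniqP; rewrite -cardsE te ek size_tuple.
    rewrite inE {1}tE /= => /andP[iN ->]; rewrite andbT.
    apply/allP => x xt /=; rewrite !inE (_ : x \in e); last first.
      by rewrite -te inE memtE tE inE xt orbT.
    rewrite andbT.
    by apply: contraNneq iN => <-.
  by apply: val_inj; rewrite /= -(ohead_cons ht).
rewrite inE => /andP[/allP sall su] ->; split=> //=.
rewrite eqEcard ek; apply/andP; split.
  apply/fintype.subsetP => x; rewrite !inE => /orP[/eqP -> //|/sall].
  by rewrite !inE => /andP[].
have : uniq (h s).
  by rewrite /= su andbT; apply/negP => /sall; rewrite !inE eqxx.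
by move=> /card_uniqP sE; rewrite cardsE sE size_tuple.
Qed.

Lemma adjacency_applyE (R : realType) (k : nat) (H : hypergraph)
    (x : {ffun H -> R[i]}) (i : H) :
  (0 < k)%N -> uniform k H ->
  tensor_apply (@adjacency_tensor R k H) x i =
  \sum_(e in edges H | i \in e) \prod_(u in e :\ i) x u.
Proof.
case: k => // k _ Hk; rewrite /tensor_apply /adjacency_tensor /=.
under eq_bigr do rewrite (fun_if (fun z => z * _)) mul0r.
rewrite -big_mkcondr /=.
rewrite (partition_big (fun t : k.+1.-tuple H => [set x in t])
  (fun e => (e \in edges H) && (i \in e))) /=; last first.
  move=> t /andP[/eqP ht ->].
  by have tE := ohead_cons ht; rewrite inE memtE tE mem_head.
apply: eq_bigr => e /andP[eE ie].
pose c : R[i] := \prod_(u in e :\ i) x u.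
rewrite (eq_bigr (fun=> k`!%:R^-1 * c)); last first.
  move=> t /andP[/andP[ht _] /eqP te]; congr (_ * _).
  have ut : uniq t by apply/card_uniqP; rewrite -cardsE te (Hk e eE) size_tuple.
  have tE := ohead_cons (eqP ht).
  have ub : uniq (behead t) by move: ut; rewrite {1}tE /= => /andP[].
  rewrite (big_uniq _ ub) /=; apply: eq_bigl => u.
  rewrite !inE -te inE memtE tE inE.
  case: eqVneq => [->|//] /=.
  by apply/negbTE; move: ut; rewrite {1}tE /= => /andP[].
rewrite sumr_const.
rewrite (_ : #|_| = k`!); last first.
  rewrite -(card_tuples_head_set ie (Hk e eE)) cardsE; apply: eq_card => t.
  rewrite [LHS]unfold_in [RHS]unfold_in /= -andbA; congr (_ && _).
  by case: eqP => [->|_]; rewrite ?eE ?andbF.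
rewrite -[LHS]mulr_natl mulrA mulfV ?mul1r //.
by rewrite pnatr_eq0 -lt0n fact_gt0.
Qed.

Definition edge_weight (R : comNzRingType) (H : hypergraph) (y : H -> R)
    (e : {set H}) : R := \prod_(u in e) y u.

(* The eigenvalue equation at v, multiplied by y v: load y v = mu * y v ^+ k. *)
Definition load (R : comNzRingType) (H : hypergraph) (y : H -> R) (v : H) : R :=
  \sum_(e in edges H | v \in e) edge_weight y e.

Lemma load_factor (R : comNzRingType) (H : hypergraph) (y : H -> R) (v : H) :
  load y v = y v * \sum_(e in edges H | v \in e) \prod_(u in e :\ v) y u.
Proof.
rewrite /load mulr_sumr; apply: eq_bigr => e /andP[_ ve].
exact: big_setD1.
Qed.

Section SpectralRadius.
Variables (R : realType) (k : nat) (H : hypergraph) (mu : R) (y : H -> R).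
Hypotheses (k_gt0 : (0 < k)%N) (Hk : uniform k H) (y_gt0 : forall v, 0 < y v).

(** Collatz-Wielandt argument: at a vertex [i] where |x v| / y v attains its maximum M, the
    eigenvalue equation and |x| <= M y give r y_i^(k-1) <= mu y_i^(k-1), once M^(k-1) is
    cancelled. *)
Lemma eigenvalue_modulus_le (l : R[i]) (r : R) :
  (forall v, load y v <= mu * y v ^+ k) ->
  eigenvalue_tensor (@adjacency_tensor R k H) l -> `|l| = (r%:C)%C -> r <= mu.
Proof.
move=> y_le [x x_neq0 xl] lr.
have [v0 xv0] : exists v, x v != 0.
  apply/existsP; apply: contra_neqT x_neq0; rewrite negb_exists => /forallP x0.
  by apply/ffunP => v; rewrite ffunE; have /negPn/eqP := x0 v.
(* The norm on [R[i]] takes values in [R[i]]; [m] is the modulus as an element of [R]. *)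
pose m v := complex.Re `|x v|.
have mE v : `|x v| = ((m v)%:C)%C by rewrite /m normc_def.
have m_ge0 v : 0 <= m v by rewrite -lecR -mE normr_ge0.
case: (arg_maxP (fun v => m v / y v) (i0 := v0) (P := xpredT) isT) => i _ imax.
set M := m i / y i in imax.
have M_gt0 : 0 < M.
  apply: lt_le_trans (imax v0 isT); rewrite divr_gt0 // -ltcR -mE normr_gt0 //.
have m_le v : m v <= M * y v by rewrite -ler_pdivrMr //; exact: imax.
have miE : m i = M * y i by rewrite divfK // gt_eqF.
have step : r * m i ^+ k.-1 <=
    \sum_(e in edges H | i \in e) \prod_(u in e :\ i) m u.
  rewrite -lecR rmorphM rmorphXn /= -mE -lr -normrX -normrM -xl.
  rewrite adjacency_applyE // rmorph_sum /=.
  apply: le_trans (ler_norm_sum _ _ _) _.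
  by apply: ler_sum => e _; rewrite normr_prod rmorph_prod.
have prod_le : \sum_(e in edges H | i \in e) \prod_(u in e :\ i) m u <=
    M ^+ k.-1 * \sum_(e in edges H | i \in e) \prod_(u in e :\ i) y u.
  rewrite mulr_sumr; apply: ler_sum => e /andP[eE ie].
  have <- : #|e :\ i| = k.-1 by rewrite -(Hk eE) (cardsD1 i e) ie.
  rewrite -prodr_const -big_split /=.
  by apply: ler_prod => u _; rewrite m_ge0 m_le.
have := le_trans step prod_le; rewrite miE exprMn mulrCA ler_pM2l ?exprn_gt0 //.
rewrite -(ler_pM2l (y_gt0 i)) -load_factor mulrCA -exprS prednK // => le1.
by rewrite -(ler_pM2r (exprn_gt0 k (y_gt0 i))) (le_trans le1).
Qed.

Lemma rho_le :
  0 <= mu -> (forall v, load y v <= mu * y v ^+ k) -> rho R k H <= mu.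
Proof.
move=> mu0 y_le; rewrite /rho /spectral_radius_tensor.
set S := [set _ | _]%classic.
have [[r Sr]|S0] := pselect (S !=set0)%classic; last first.
  (* Without eigenvalues the supremum is 0 by convention, whence the assumption [0 <= mu]. *)
  by rewrite sup_out // => -[].
apply: ge_sup; first by exists r.
by move=> s [l ev ls]; apply: eigenvalue_modulus_le ev ls.
Qed.

(** Equality makes [y], read in [R[i]], an eigenvector for [mu]. The preceding bound shows that the
    set of moduli is bounded, so its supremum dominates [mu]; [v0] only serves to see that [y] is
    nonzero. *)
Lemma rho_ge (v0 : H) :
  0 <= mu -> (forall v, load y v = mu * y v ^+ k) -> mu <= rho R k H.
Proof.
move=> mu0 y_eq; apply: ub_le_sup.
  exists mu => s [l ev ls]; apply: eigenvalue_modulus_le ev ls => v.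
  by rewrite y_eq.
exists (mu%:C)%C; last by rewrite normc_def /= expr0n addr0 sqrtr_sqr ger0_norm.
exists [ffun v => ((y v)%:C)%C].
  apply/eqP => /ffunP/(_ v0); rewrite !ffunE.
  by move=> /(congr1 (@complex.Re R))/= /eqP; rewrite gt_eqF.
move=> i; rewrite adjacency_applyE // ffunE -rmorphXn -rmorphM /=.
rewrite (_ : mu * _ = \sum_(e in edges H | i \in e) \prod_(u in e :\ i) y u).
  rewrite rmorph_sum; apply: eq_bigr => e _; rewrite rmorph_prod.
  by apply: eq_bigr => u _; rewrite ffunE.
apply: (mulfI (lt0r_neq0 (y_gt0 i))).
by rewrite -load_factor y_eq mulrCA -exprS prednK.
Qed.

End SpectralRadius.

(** * Weights of a loose path *)

Section PathWeights.
Variables (R : realFieldType) (c : R).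
Hypothesis c_gt0 : 0 < c.

(* c ^+ n.+1 * (c^j + c^-j + c + c^-1) with j = n + 1 - 2 i, for i <= n.+1. *)
Definition cosh_weight (n i : nat) : R :=
  c ^+ (2 * (n.+1 - i)) + c ^+ (2 * i) + c ^+ n + c ^+ n.+2.

(** The number z_i. Indices 1 to n are the edges of the path; 0 and n+1 stand for the edges at its
    two ends, with z = 1. *)
Definition path_weight (n i : nat) : R := cosh_weight n i / cosh_weight n 0.

Definition end_weight (n : nat) : R :=
  (1 + c ^+ 2) * (1 + c ^+ n) / (1 + c ^+ n.+2).

Lemma cosh_weight_gt0 n i : 0 < cosh_weight n i.
Proof. by rewrite /cosh_weight !addr_gt0 ?exprn_gt0. Qed.

Lemma path_weight_gt0 n i : 0 < path_weight n i.
Proof. by rewrite divr_gt0 ?cosh_weight_gt0. Qed.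

Lemma path_weight_first n : path_weight n 0 = 1.
Proof. by rewrite /path_weight divff // gt_eqF ?cosh_weight_gt0. Qed.

Lemma path_weight_sym n i : (i <= n.+1)%N ->
  path_weight n (n.+1 - i) = path_weight n i.
Proof.
move=> le_in; rewrite /path_weight; congr (_ / _); rewrite /cosh_weight subKn //.
by rewrite [X in X + _ + _]addrC.
Qed.

Lemma path_weight_rec n i : (i < n)%N ->
  (path_weight n i + path_weight n i.+1) *
    (path_weight n i.+1 + path_weight n i.+2) =
  ((1 + c ^+ 2) / c) ^+ 2 * path_weight n i.+1 ^+ 2.
Proof.
move=> lt_in; have Z0 := gt_eqF (cosh_weight_gt0 n 0); rewrite /path_weight.
suff E : c ^+ 2 * ((cosh_weight n i + cosh_weight n i.+1) *
    (cosh_weight n i.+1 + cosh_weight n i.+2)) =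
    (1 + c ^+ 2) ^+ 2 * cosh_weight n i.+1 ^+ 2.
  rewrite -!mulrDl mulrACA -invfM -expr2 (canRL (mulKf _) E); last first.
    by rewrite expf_neq0 // gt_eqF.
  by field; rewrite Z0 gt_eqF.
(* This substitution removes the truncated subtractions, so that the recurrence becomes a polynomial
   identity in c, c^m and c^i. *)
rewrite /cosh_weight; have [m ->] : exists m, n = (m + i).+1.
  by exists (n - i.+1)%N; lia.
rewrite (_ : (m + i).+2 - i = m.+2)%N; last lia.
rewrite (_ : (m + i).+2 - i.+1 = m.+1)%N; last lia.
rewrite (_ : (m + i).+2 - i.+2 = m)%N; last lia.
rewrite !mulnS !(mulnC 2%N) !exprD !exprM !exprS !exprD; ring.
Qed.

Lemma end_weightE n : 1 + path_weight n 1 = end_weight n.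
Proof.
rewrite /path_weight /end_weight /cosh_weight.
have p0 m : 0 < 1 + c ^+ m by rewrite addr_gt0 ?exprn_gt0.
rewrite subn0 subSS subn0 muln0 muln1 !(mulnC 2%N) !exprM.
(* The normalising denominator [cosh_weight n 0] factors. *)
have -> : (c ^+ n.+1) ^+ 2 + c ^+ 0 + c ^+ n + c ^+ n.+2 =
   (1 + c ^+ n) * (1 + c ^+ n.+2) by rewrite !exprS; ring.
have [pn pn2] := (p0 n, p0 n.+2); move: pn pn2; rewrite !(exprS c) => pn pn2.
by field; rewrite !gt_eqF.
Qed.

Lemma end_weight_gt0 n : 0 < end_weight n.
Proof. by rewrite divr_gt0 ?mulr_gt0 ?addr_gt0 ?exprn_gt0. Qed.

(** A path of length 0 puts the merged vertex in two edges with z = 1. *)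
Lemma end_weight0 : end_weight 0 = 2.
Proof.
rewrite /end_weight; field.
by rewrite gt_eqF // addr_gt0 ?exprn_gt0.
Qed.

End PathWeights.

(** * Comparison of the roots of the two equations *)

Section Roots.
Variables (R : rcfType) (p q : nat).

(* The roots of gap3 in (0, 1) solve the equation of C3(p+1, q+1), those of gap2
   the equation of C2(p, q, 1). *)
Let gap3 (c : R) := (1 + c ^+ p.+3) * (1 + c ^+ q.+3)
  - c * (1 + c ^+ 2) * (1 + c ^+ p.+1) * (1 + c ^+ q.+1).
Let gap2 (c : R) := (1 + c ^+ p.+2) * (1 + c ^+ q.+2) * (1 - c + c ^+ 2)
  - c ^+ 2 * (1 + c ^+ 2) * (1 + c ^+ p) * (1 + c ^+ q).

(* The factor (1+c^n)(1+c^(n+3)) / ((1+c^(n+1))(1+c^(n+2))), by which the two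
   equations differ, is largest for n = 0. *)
Lemma end_ratio_le (c : R) n : 0 < c < 1 ->
  (1 + c ^+ n) * (1 + c ^+ n.+3) * (1 + c ^+ 2) <=
  2 * (1 - c + c ^+ 2) * ((1 + c ^+ n.+1) * (1 + c ^+ n.+2)).
Proof.
move=> /andP[c0 c1]; set a := c ^+ n.
have a0 : 0 < a by rewrite exprn_gt0.
have a1 : a <= 1 by rewrite exprn_ile1 // ltW.
rewrite !(exprS c n.+2) !(exprS c n.+1) !(exprS c n) -/a -subr_ge0.
rewrite (_ : _ - _ = (1 - c) ^+ 2 * ((1 - a) * (1 - a * c ^+ 3))); last ring.
have c31 : c ^+ 3 <= 1 by rewrite exprn_ile1 // ltW.
have ac3 : a * c ^+ 3 <= 1 by rewrite mulr_ile1 // ?exprn_ge0 // ltW.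
by apply: mulr_ge0; [exact: sqr_ge0 | apply: mulr_ge0; rewrite subr_ge0].
Qed.

(** After multiplication by (1+c^(p+1))(1+c^(q+1)), the equation [gap3 c = 0] turns the negative
    term of [gap2] into c (1+c^p)(1+c^(p+3))(1+c^q)(1+c^(q+3)). Bounding this by [end_ratio_le] for
    p and for q leaves 4c(1-c+c^2) < (1+c^2)^2, and the difference of the two sides is (1-c)^4. *)
Lemma gap2_gt0 (c : R) : 0 < c < 1 -> gap3 c = 0 -> 0 < gap2 c.
Proof.
move=> c01; have /andP[c0 c1] := c01.
have pos n : 0 < 1 + c ^+ n by rewrite addr_gt0 ?exprn_gt0.
rewrite /gap3 /gap2 => /eqP; rewrite subr_eq0 => /eqP GE; rewrite subr_gt0.
have u0 := pos p.+1; have v0 := pos q.+1.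
rewrite -(ltr_pM2r (mulr_gt0 u0 v0)).
have t0 : 0 < 1 - c + c ^+ 2 by nra.
have rp := end_ratio_le p c01; have rq := end_ratio_le q c01.
have rpq := ler_pM (ltW (mulr_gt0 (mulr_gt0 (pos p) (pos p.+3)) (pos 2)))
  (ltW (mulr_gt0 (mulr_gt0 (pos q) (pos q.+3)) (pos 2))) rp rq.
rewrite (_ : _ ^+ 2 * _ * _ * _ * _ =
  c * ((1 + c ^+ p) * (1 + c ^+ q)) * ((1 + c ^+ p.+3) * (1 + c ^+ q.+3))); last first.
  by rewrite GE; ring.
rewrite -(ltr_pM2r (exprn_gt0 2 (pos 2))).
set X := (1 + c ^+ p.+1) * (1 + c ^+ p.+2) in rpq.
set Y := (1 + c ^+ q.+1) * (1 + c ^+ q.+2) in rpq.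
have X0 : 0 < X by rewrite mulr_gt0.
have Y0 : 0 < Y by rewrite mulr_gt0.
apply: (@le_lt_trans _ _ (c * (4 * (1 - c + c ^+ 2) ^+ 2 * (X * Y)))).
  move: rpq; rewrite -(ler_pM2l c0); congr (_ <= _); rewrite /X /Y; ring.
rewrite (_ : (1 + _) * _ * _ * _ * _ =
  (1 - c + c ^+ 2) * (1 + c ^+ 2) ^+ 2 * (X * Y)); last by rewrite /X /Y; ring.
rewrite mulrA ltr_pM2r ?mulr_gt0 // -subr_gt0.
rewrite (_ : _ - _ = (1 - c + c ^+ 2) * (1 - c) ^+ 4); last ring.
by rewrite mulr_gt0 // exprn_gt0 // subr_gt0.
Qed.

(** The intermediate value theorem on [0, 1] gives c; as [gap2] is positive at c and negative at 1,
    it gives d on [c, 1]. *)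
Lemma end_weight_roots : exists c d : R, [/\ 0 < c, c < d, d < 1,
  end_weight c p.+1 * end_weight c q.+1 = (1 + c ^+ 2) / c &
  end_weight d p * end_weight d q * end_weight d 1 = ((1 + d ^+ 2) / d) ^+ 2].
Proof.
pose PG : {poly R} := (1 + 'X ^+ p.+3) * (1 + 'X ^+ q.+3)
  - 'X * (1 + 'X ^+ 2) * (1 + 'X ^+ p.+1) * (1 + 'X ^+ q.+1).
pose PH : {poly R} := (1 + 'X ^+ p.+2) * (1 + 'X ^+ q.+2) * (1 - 'X + 'X ^+ 2)
  - 'X ^+ 2 * (1 + 'X ^+ 2) * (1 + 'X ^+ p) * (1 + 'X ^+ q).
have PGE x : PG.[x] = gap3 x by rewrite /PG /gap3 !hornerE.
have PHE x : PH.[x] = gap2 x by rewrite /PH /gap2 !hornerE.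
have G0 : gap3 0 = 1 by rewrite /gap3 !exprS !mul0r; ring.
have G1 : gap3 1 = - 4 by rewrite /gap3 !expr1n; ring.
have H1 : gap2 1 = - 4 by rewrite /gap2 !expr1n; ring.
(* [poly_ivt] asks for a change from nonpositive to nonnegative, hence the opposite polynomial. *)
have [||c /andP[c0 c1] /rootP] := @poly_ivt R (- PG) 0 1; first exact: ler01.
  by rewrite !hornerN !PGE G0 G1; lra.
rewrite hornerN PGE => /eqP; rewrite oppr_eq0 => /eqP Gc.
have {}c0 : 0 < c.
  by rewrite lt_neqAle c0 andbT; apply/eqP => E; move: Gc; rewrite -E G0; lra.
have {}c1 : c < 1.
  by rewrite lt_neqAle c1 andbT; apply/eqP => E; move: Gc; rewrite E G1; lra.
have Hc : 0 < gap2 c by apply: gap2_gt0 => //; rewrite c0.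
have [||d /andP[cd d1] /rootP] := @poly_ivt R (- PH) c 1; first exact: ltW.
  by rewrite !hornerN !PHE H1; lra.
rewrite hornerN PHE => /eqP; rewrite oppr_eq0 => /eqP Hd.
have {}cd : c < d.
  by rewrite lt_neqAle cd andbT; apply/eqP => E; move: Hc; rewrite E Hd; lra.
have {}d1 : d < 1.
  by rewrite lt_neqAle d1 andbT; apply/eqP => E; move: Hd; rewrite E H1; lra.
have d0 := lt_trans c0 cd.
have pos (x : R) n : 0 < x -> 0 < 1 + x ^+ n.
  by move=> x0; rewrite addr_gt0 ?exprn_gt0.
exists c, d; split=> //; rewrite /end_weight.
  move/eqP: Gc; rewrite /gap3 subr_eq0 => /eqP Gc.
  rewrite mulf_div Gc; field.
  by rewrite !gt_eqF ?pos.
move/eqP: Hd; rewrite /gap2 subr_eq0 => /eqP Hd.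
have dt : 0 < 1 - d + d ^+ 2 by nra.
(* The factor 1 + d cancels in [end_weight d 1], which leaves the 1 - d + d^2 of [gap2]. *)
rewrite (_ : 1 + d ^+ 3 = (1 + d) * (1 - d + d ^+ 2)); last ring.
rewrite expr1 !mulf_div.
rewrite (_ : (1 + d ^+ p.+2) * _ * _ = (1 + d) *
   ((1 + d ^+ p.+2) * (1 + d ^+ q.+2) * (1 - d + d ^+ 2))); last ring.
rewrite Hd; field.
by rewrite !gt_eqF ?pos // addr_gt0.
Qed.

End Roots.

(** * Joining two vertices *)

Section RootLoad.
Variables (R : realType) (k : nat) (mu : R).
Hypothesis k_gt0 : (0 < k)%N.

Definition kroot (x : R) : R := x `^ k%:R^-1.

Lemma kroot_gt0 x : 0 < x -> 0 < kroot x.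
Proof. exact: powR_gt0. Qed.

Lemma krootK x : 0 < x -> kroot x ^+ k = x.
Proof.
move=> x0; rewrite -powR_mulrn ?powR_ge0 // -powRrM mulVf ?powRr1 ?ltW //.
by rewrite pnatr_eq0 -lt0n.
Qed.

(** In terms of w = y^k the eigenvector condition at v is [wload w v = mu * w v], without powers on
    the right. *)
Definition wload (H : hypergraph) (w : H -> R) (v : H) : R :=
  load (fun u => kroot (w u)) v.

Lemma prod_kroot (I : finType) (P : pred I) (w : I -> R) (z : R) :
  (forall i, 0 < w i) -> 0 <= z -> \prod_(i | P i) w i = z ^+ k ->
  \prod_(i | P i) kroot (w i) = z.
Proof.
move=> w0 z0 wz; apply: (@pexpIrn _ k) => //.
- by rewrite nnegrE prodr_ge0 // => i _; rewrite ltW ?kroot_gt0.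
- by rewrite -prodrXl -wz; apply: eq_bigr => i _; rewrite krootK.
Qed.

Lemma rho_le_wload (H : hypergraph) (w : H -> R) :
  uniform k H -> 0 <= mu -> (forall v, 0 < w v) ->
  (forall v, wload w v <= mu * w v) -> rho R k H <= mu.
Proof.
move=> Hk mu0 w0 wl; apply: (rho_le (y := fun v => kroot (w v))) => // v.
  exact: kroot_gt0.
by rewrite krootK //; exact: wl.
Qed.

Lemma rho_ge_wload (H : hypergraph) (w : H -> R) (v0 : H) :
  uniform k H -> 0 <= mu -> (forall v, 0 < w v) ->
  (forall v, wload w v = mu * w v) -> mu <= rho R k H.
Proof.
move=> Hk mu0 w0 wl; apply: (rho_ge (y := fun v => kroot (w v))) => // v.
  exact: kroot_gt0.
by rewrite krootK //; exact: wl.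
Qed.

End RootLoad.

(** * Adding a loose path of positive length *)

Section AddPath.
Variables (H : hypergraph) (a b : H) (k n : nat).
Hypotheses (ab : a != b) (n_gt0 : (0 < n)%N) (k_gt2 : (2 < k)%N).
Let K := k.-1.
Let N := (n * K)%N.

Lemma mem_path_vertex (i : 'I_n) (m : nat) : (m <= N)%N ->
  (path_vertex a b N m \in path_edge a b k i) = (i * K <= m <= i.+1 * K)%N.
Proof.
move=> mN; have iN : (i.+1 * K <= N)%N by rewrite leq_mul2r ltn_ord orbT.
apply/imsetP/idP => [[j _ /path_vertex_inj]|/andP[im mi]].
  have jk := ltn_ord j; rewrite mulSn in iN.
  move=> /(_ ab mN) ->; first by rewrite mulSn /K in iN *; lia.
  by rewrite -/K; rewrite /K in iN *; lia.
have mk : (m - i * K < k)%N by rewrite mulSn /K in mi *; lia.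
by exists (Ordinal mk) => //=; rewrite subnKC.
Qed.

Lemma path_vertexP (v : H + 'I_N.-1) :
  (exists2 m : nat, (m <= N)%N & v = path_vertex a b N m) \/
  (exists2 x, x \notin [:: a; b] & v = inl x).
Proof.
have N0 : (0 < N)%N by rewrite muln_gt0 n_gt0 /K; lia.
case: v => [x|j]; last first.
  left; exists j.+1; first by have := ltn_ord j; lia.
  by rewrite /path_vertex /= valK.
have [|xab] := boolP (x \in [:: a; b]); last by right; exists x.
rewrite !inE => /orP[]/eqP->; left; first by exists 0%N.
exists N => //; rewrite /path_vertex gtn_eqF //.
by case: insubP => // j; rewrite ltnn.
Qed.

(** Since k > 2, the second vertex of a path edge lies in no other path edge. It is also a new
    vertex, so path edges differ from each other and from the old edges. *)
Lemma path_edge_mid (i j : 'I_n) :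
  (path_vertex a b N (i * K).+1 \in path_edge a b k j) = (i == j).
Proof.
have iN : (i.+1 * K <= N)%N by rewrite leq_mul2r ltn_ord orbT.
have K2 : (1 < K)%N by rewrite /K; lia.
rewrite mem_path_vertex; last by rewrite mulSn in iN; lia.
apply/andP/eqP => [[ji ij]|->]; last by rewrite mulSn; split; lia.
by apply: val_inj => /=; nia.
Qed.

Lemma path_edge_inj : injective (@path_edge H a b k n).
Proof. by move=> i j ij; apply/eqP; rewrite -path_edge_mid -ij path_edge_mid. Qed.

Lemma path_edge_notin_imset (i : 'I_n) (E : {set {set H}}) :
  path_edge a b k i \notin [set [set inl x | x in e] | e : {set H} in E].
Proof.
apply/imsetP => -[e _ ie]; have := path_edge_mid i i; rewrite ie eqxx.
have iN : (i.+1 * K <= N)%N by rewrite leq_mul2r ltn_ord orbT.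
have K2 : (1 < K)%N by rewrite /K; lia.
rewrite /path_vertex /=; case: insubP => [j _ _|]; first by move=> /imsetP[].
by rewrite mulSn in iN; lia.
Qed.

Lemma load_add_path (R : comNzRingType) (y : H + 'I_N.-1 -> R)
    (v : add_path k a b n) :
  @load R (add_path k a b n) y v =
  (if v is inl x then load (y \o inl) x else 0) +
  \sum_(i < n | v \in path_edge a b k i)
    @edge_weight R (add_path k a b n) y (path_edge a b k i).
Proof.
have inlI : injective (@inl H 'I_N.-1) by exact: inl_inj.
rewrite /load big_mkcondr /=.
set A := imset _ _; set B := imset _ _.
rewrite (eq_bigl [in [predU A & B]]) => [|E]; last by rewrite !inE.
rewrite bigU /=; last first.
  rewrite -setI_eq0; apply/eqP/setP => E; rewrite !inE.
  apply/andP => -[+ /imsetP[i _ Ei]]; rewrite Ei.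
  by apply/negP; exact: path_edge_notin_imset.
congr (_ + _); last first.
  rewrite big_imset /=; last by move=> i j _ _; exact: path_edge_inj.
  by rewrite -big_mkcondr.
rewrite big_imset /=; last by move=> e f _ _; exact: imset_inj.
case: v => [x|j].
  rewrite [RHS]big_mkcondr; apply: eq_bigr => e _.
  rewrite mem_imset //; case: ifP => // _.
  by rewrite /edge_weight big_imset //= => u v _ _; exact: inlI.
apply: big1 => e _; case: ifP => // /imsetP[] //.
Qed.

Variables (R : realType) (c mu : R) (w : H -> R).
Hypotheses (c_gt0 : 0 < c) (mu_gt0 : 0 < mu).
Hypothesis muk : mu ^+ k = ((1 + c ^+ 2) / c) ^+ 2.
Hypotheses (w_gt0 : forall x, 0 < w x).
Hypotheses (wa : w a = end_weight c n) (wb : w b = end_weight c n).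

(** The sum of z over the edges at the vertex numbered m: two edges meet at multiples of K, all
    other vertices are inner. The edge [i : 'I_n] has the weight of index [i.+1]. *)
Definition number_weight (m : nat) : R :=
  if (K %| m)%N then path_weight c n (m %/ K) + path_weight c n (m %/ K).+1
  else path_weight c n (m %/ K).+1.

Definition path_extension (v : add_path k a b n) : R :=
  match v with inl x => w x | inr j => number_weight j.+1 end.

Lemma number_weight_gt0 m : 0 < number_weight m.
Proof.
by rewrite /number_weight; case: ifP => _; rewrite ?addr_gt0 ?path_weight_gt0.
Qed.

Lemma path_extension_gt0 v : 0 < path_extension v.
Proof. by case: v => [x|j] /=; rewrite ?w_gt0 ?number_weight_gt0. Qed.

(** At the ends this is the assumption on [w a] and [w b]: [end_weight c n] is z_0 + z_1, and by
    symmetry z_n + z_(n+1). *)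
Lemma path_extension_vertex m : (m <= N)%N ->
  path_extension (path_vertex a b N m) = number_weight m.
Proof.
have K0 : (0 < K)%N by rewrite /K; lia.
move=> mN; rewrite /path_vertex; case: eqVneq => [->|m0].
  by rewrite /= wa /number_weight dvdn0 div0n path_weight_first // end_weightE.
case: insubP => [j _ jm|mN1] /=; first by rewrite jm prednK ?lt0n.
have -> : m = N by apply/anti_leq; rewrite mN /=; lia.
rewrite /number_weight dvdn_mull // mulnK // wb -end_weightE //.
have := path_weight_sym c (leq0n n.+1); rewrite subn0 path_weight_first // => ->.
have := @path_weight_sym _ c n 1 isT; rewrite subSS subn0 => ->.
by rewrite addrC.
Qed.

(** With z = z_(i+1), the two end vertices of the edge contribute mu^k z^2 by [path_weight_rec], and
    its k-2 inner vertices contribute z^(k-2). *)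
Lemma path_edge_weight (i : 'I_n) :
  edge_weight (fun v => kroot k (path_extension v))
    (path_edge a b k i : {set add_path k a b n}) = mu * path_weight c n i.+1.
Proof.
have iN : (i.+1 * K <= N)%N by rewrite leq_mul2r ltn_ord orbT.
have jN (j : 'I_k) : (i * K + j <= N)%N.
  by have := ltn_ord j; rewrite mulSn /K in iN *; lia.
apply: prod_kroot; first by lia.
- exact: path_extension_gt0.
- by rewrite ltW // mulr_gt0 ?path_weight_gt0.
rewrite big_imset /=; last first.
  move=> j j' _ _ /path_vertex_inj E; apply: val_inj.
  by apply: (@addnI (i * K)%N); exact: (E ab (jN j) (jN j')).
under eq_bigr do rewrite path_extension_vertex //.
rewrite exprMn muk.
have [K' kK] : exists K', k = K'.+2 by exists (k - 2)%N; lia.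
have KE : K = K'.+1 by rewrite /K kK.
rewrite -(big_mkord xpredT (fun j => number_weight (i * K + j)%N)) kK.
rewrite big_nat_recl // big_nat_recr //= addn0 -KE -mulSnr.
rewrite {1 3}/number_weight !dvdn_mull // !mulnK ?KE // -KE.
rewrite (eq_big_nat _ _ (F2 := fun=> path_weight c n i.+1)); last first.
  move=> j /andP[_ jK]; have jK1 : (j.+1 < K)%N by rewrite KE.
  rewrite /number_weight dvdn_addr ?dvdn_mull // gtnNdvd //.
  by rewrite divnMDl ?KE // -KE divn_small // addn0.
rewrite prodr_const_nat subn0 mulrCA path_weight_rec //.
by rewrite mulrCA -exprD KE addn2.
Qed.

Lemma wload_add_path_old x : x \notin [:: a; b] ->
  @wload R k (add_path k a b n) path_extension (inl x) = wload k w x.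
Proof.
move=> xab; rewrite /wload load_add_path big1 ?addr0 // => i ix.
by rewrite (mem_path_edge ix) in xab.
Qed.

(** The path edges account for all of [number_weight m], except at the ends, where z_0 = 1 or
    z_(n+1) = 1 belongs to an edge outside the path. *)
Lemma sum_path_edges m : (m <= N)%N ->
  \sum_(i < n | path_vertex a b N m \in path_edge a b k i)
    mu * path_weight c n i.+1 =
  mu * (number_weight m - ((m == 0%N) || (m == N))%:R).
Proof.
have K0 : (0 < K)%N by rewrite /K; lia.
move=> mN; rewrite -mulr_sumr; congr (_ * _).
under eq_bigl do rewrite mem_path_vertex //.
set d := (m %/ K)%N.
have mE : m = (d * K + m %% K)%N by exact: divn_eq.
have sK : (m %% K < K)%N by rewrite ltn_mod.
rewrite /number_weight -/d.
have [/eqP Km|Km] := boolP (K %| m)%N; last first.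
  have s0 : (0 < m %% K)%N by rewrite lt0n.
  have dn : (d < n)%N by rewrite /N in mN; nia.
  rewrite (_ : (m == 0%N) || (m == N) = false) ?subr0; last first.
    by apply/negbTE; rewrite negb_or; apply/andP; split;
      apply: contraNneq Km => ->; rewrite ?dvdn0 ?dvdn_mull.
  rewrite (big_pred1 (Ordinal dn)) // => i.
  by rewrite /= -val_eqE /=; apply/andP/eqP => [[]|->]; rewrite ?mulSn; nia.
have {sK Km}mE : m = (d * K)%N by rewrite mE Km addn0.
have cond (i : 'I_n) : (i * K <= m <= i.+1 * K)%N = (i <= d <= i.+1)%N.
  by rewrite mE !leq_pmul2r.
under eq_bigl do rewrite cond.
have dn : (d <= n)%N by move: mN; rewrite mE leq_pmul2r.
have -> : (m == 0%N) = (d == 0%N) by rewrite mE muln_eq0 (gtn_eqF K0) orbF.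
have -> : (m == N) = (d == n) by rewrite mE eqn_pmul2r.
have [d0|d0] := posnP d.
  rewrite d0 (big_pred1 (Ordinal n_gt0)).
    by rewrite path_weight_first // addrAC subrr add0r.
  by move=> i; rewrite /= -val_eqE /=; lia.
have dp : (d.-1 < n)%N by lia.
move: dn; rewrite leq_eqVlt => /predU1P[dE|dn].
  rewrite dE eqxx (big_pred1 (Ordinal dp)) => [|i] /=.
    have := path_weight_sym c (leq0n n.+1).
    by rewrite subn0 path_weight_first // => ->; rewrite addrK dE prednK.
  by have := ltn_ord i; rewrite /= -val_eqE /=; lia.
rewrite (ltn_eqF dn) subr0 (bigD1 (Ordinal dp)) /=; last by lia.
rewrite prednK // (big_pred1 (Ordinal dn)) // => i.
by rewrite /= -!val_eqE /=; lia.
Qed.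

Lemma wload_add_path_vertex m : (m <= N)%N ->
  wload k path_extension (path_vertex a b N m : add_path k a b n) =
  (if m == 0%N then wload k w a else if m == N then wload k w b else 0)
  + mu * (number_weight m - ((m == 0%N) || (m == N))%:R).
Proof.
move=> mN; rewrite /wload load_add_path.
rewrite (eq_bigr (fun i : 'I_n => mu * path_weight c n i.+1)); last first.
  by move=> i _; rewrite path_edge_weight.
rewrite sum_path_edges //; congr (_ + _).
rewrite {1}/path_vertex; case: eqVneq => // m0.
case: insubP => [j jN _|mN1].
  by rewrite ltn_eqF //; lia.
by rewrite ifT //; apply/eqP; lia.
Qed.

(** At an end the path supplies all but [mu] of the required load; the old edges supply at most this
    [mu]. *)
Lemma wload_add_path_le : wload k w a <= mu -> wload k w b <= mu ->
  forall v, (exists2 x, x \notin [:: a; b] & v = inl x) \/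
    wload k path_extension v <= mu * path_extension v.
Proof.
move=> la lb v; have [[m mN ->]|] := path_vertexP v; last by left.
right; rewrite wload_add_path_vertex // path_extension_vertex //.
rewrite mulrBr; case: eqP => _ /=; first by rewrite mulr1; lra.
by case: eqP => _ /=; rewrite ?mulr1 ?mulr0; lra.
Qed.

Lemma wload_add_path_eq : wload k w a = mu -> wload k w b = mu ->
  forall v, (exists2 x, x \notin [:: a; b] & v = inl x) \/
    wload k path_extension v = mu * path_extension v.
Proof.
move=> la lb v; have [[m mN ->]|] := path_vertexP v; last by left.
right; rewrite wload_add_path_vertex // path_extension_vertex //.
rewrite mulrBr; case: eqP => _ /=; first by rewrite mulr1; lra.
by case: eqP => _ /=; rewrite ?mulr1 ?mulr0; lra.
Qed.

End AddPath.

(** * Identifying two vertices *)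

Lemma ler_sum_imset (R : numDomainType) (I J : finType) (h : I -> J)
    (A : {set I}) (P : pred J) (F : J -> R) : (forall j, 0 <= F j) ->
  \sum_(j in h @: A | P j) F j <= \sum_(i in A | P (h i)) F (h i).
Proof.
move=> F0; rewrite big_mkcondr [leRHS]big_mkcondr /= (partition_big_imset h) /=.
apply: ler_sum => _ /imsetP[i iA ->].
(* One preimage of each image point gives the term on the left; the others add nonnegative terms. *)
rewrite (bigD1 i) /=; last by rewrite iA eqxx.
by rewrite lerDl sumr_ge0 // => i' _; case: ifP.
Qed.

Section Identify.
Variables (R : realType) (k : nat) (H : hypergraph) (a b : H) (w : H -> R).
Hypotheses (sab : separated a b) (w_gt0 : forall x, 0 < w x) (wab : w a = w b).
Let emb (x : H) : identify a b := insub x.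

Definition identify_extension (v : identify a b) : R :=
  if v is Some x then w (val x) else w a.

Lemma identify_extension_gt0 v : 0 < identify_extension v.
Proof. by case: v => [x|] /=. Qed.

Lemma identify_extension_emb x : identify_extension (emb x) = w x.
Proof.
rewrite /emb; case: insubP => [u _ ux|] /=; first by rewrite ux.
by rewrite negbK !inE => /orP[]/eqP->.
Qed.

(* Only an inequality: distinct edges may become equal under the identification. *)
Lemma wload_identify_le (v : identify a b) :
  wload k identify_extension v <=
  \sum_(e in edges H | v \in [set emb x | x in e])
    edge_weight (fun x => kroot k (w x)) e.
Proof.
apply: le_trans (ler_sum_imset _ _ _ _) _ => [E|].
  by apply: prodr_ge0 => u _; rewrite ltW // kroot_gt0 ?identify_extension_gt0.
apply: ler_sum => e /andP[eE _].
rewrite le_eqVlt; apply/orP; left; apply/eqP.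
rewrite /edge_weight big_imset /=.
  by apply: eq_bigr => x _; rewrite identify_extension_emb.
move=> x x' xe x'e /insub_notin_inj[//|/andP[]].
have [_ /(_ e eE)] := sab; rewrite !inE => nab.
by move=> /orP[]/eqP ex /orP[]/eqP ex'; subst => //; rewrite xe x'e in nab.
Qed.

Lemma wload_identify_old x : x \notin [:: a; b] ->
  wload k identify_extension (emb x) <= wload k w x.
Proof.
move=> xab; apply: le_trans (wload_identify_le _) _.
rewrite le_eqVlt; apply/orP; left; apply/eqP; apply: eq_bigl => e.
congr (_ && _); apply/imsetP/idP => [[x' x'e /insub_notin_inj[->//|]]|xe].
  by rewrite (negbTE xab).
by exists x.
Qed.

(** An edge whose image contains the merged vertex contains [a] or [b], so its weight occurs in one
    of the two loads. *)
Lemma wload_identify_new :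
  wload k identify_extension None <= wload k w a + wload k w b.
Proof.
apply: le_trans (wload_identify_le _) _; rewrite /wload /load.
rewrite big_mkcondr [X in _ <= X + _]big_mkcondr [X in _ <= _ + X]big_mkcondr.
rewrite -big_split /=; apply: ler_sum => e _.
have e0 : 0 <= edge_weight (fun x => kroot k (w x)) e.
  by apply: prodr_ge0 => u _; rewrite ltW // kroot_gt0.
case: ifP => [/imsetP[x xe]|_]; last by apply: addr_ge0; case: ifP.
rewrite /emb; case: insubP => // /negPn + _; rewrite !inE.
by move=> /orP[]/eqP <-; rewrite xe ?lerDl ?lerDr; case: ifP.
Qed.

Lemma wload_identify_cases (mu : R) :
  w a = 2 -> wload k w a <= mu -> wload k w b <= mu ->
  forall v, (exists2 x, x \notin [:: a; b] & v = emb x) \/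
    wload k identify_extension v <= mu * identify_extension v.
Proof.
move=> wa la lb [x|]; [left|right].
  by exists (val x); [exact: (valP x) | rewrite /emb valK].
apply: le_trans wload_identify_new _; rewrite /= wa; lra.
Qed.

End Identify.

(* The vertices a and b lack end_weight c n - 1 of their weight, which is exactly
   what the path brings. *)
Lemma join_wload_le (R : realType) (H : hypergraph) (a b : H) (k n : nat)
    (c mu : R) (w : H -> R) :
  (2 < k)%N -> 0 < c -> 0 < mu -> mu ^+ k = ((1 + c ^+ 2) / c) ^+ 2 ->
  separated a b -> (forall x, 0 < w x) ->
  w a = end_weight c n -> w b = end_weight c n ->
  wload k w a <= mu -> wload k w b <= mu ->
  exists w' : join k a b n -> R, [/\ forall v, 0 < w' v,
    forall x, w' (join_emb k a b n x) = w x,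
    forall x, x \notin [:: a; b] ->
      wload k w' (join_emb k a b n x) <= wload k w x &
    forall v, wload k w' v <= mu * w' v \/
      exists2 x, v = join_emb k a b n x & wload k w' v <= wload k w x].
Proof.
move=> k2 c0 mu0 muk sab w0 wa wb la lb.
have ab : a != b by case: sab.
have wab : w a = w b by rewrite wa wb.
case: n wa wb => [|n] wa wb /=.
  rewrite end_weight0 // in wa wb.
  exists (identify_extension w); split.
  - exact: identify_extension_gt0.
  - exact: identify_extension_emb.
  - by move=> x xab; apply: wload_identify_old.
  - move=> v; have [[x xab ->]|] := wload_identify_cases sab w0 wab wa la lb v.
      by right; exists x => //; apply: wload_identify_old.
    by left.
exists (@path_extension H a b k n.+1 R c w); split=> //.
- exact: path_extension_gt0.
- by move=> x xab; rewrite wload_add_path_old.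
- move=> v.
  have [[x xab ->]|] := wload_add_path_le ab (ltn0Sn n) k2 c0 mu0 muk w0 wa wb la lb v.
    by right; exists x => //; rewrite wload_add_path_old.
  by left.
Qed.

(** * Weights prescribed on a list of vertices *)

Definition list_weight (R : realType) (T : eqType) (s : seq T) (ws : seq R)
  (* The default 1 is the weight of a vertex whose only edge has z = 1. *)
  (x : T) : R := nth 1 ws (index x s).

Lemma list_weight_nth (R : realType) (T : eqType) (x0 : T) (s : seq T)
    (ws : seq R) (i : nat) :
  uniq s -> (i < size s)%N -> list_weight s ws (nth x0 s i) = nth 1 ws i.
Proof. by move=> us si; rewrite /list_weight index_uniq. Qed.

Lemma list_weight_notin (R : realType) (T : eqType) (s : seq T) (ws : seq R)
    (x : T) :
  size ws = size s -> x \notin s -> list_weight s ws x = 1.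
Proof.
move=> sz; rewrite -index_mem -leqNgt => xs.
by rewrite /list_weight nth_default // sz.
Qed.

Lemma list_weight_all (R : realType) (T : eqType) (s : seq T) (ws : seq R)
    (P : pred R) (x : T) :
  P 1 -> all P ws -> P (list_weight s ws x).
Proof.
move=> P1 /allP Pws; rewrite /list_weight.
have [lt|le] := ltnP (index x s) (size ws); last by rewrite nth_default.
by rewrite Pws // mem_nth.
Qed.

Lemma prod_list_weight (R : realType) (T : finType) (s : seq T) (ws : seq R) :
  uniq s -> size ws = size s -> \prod_x list_weight s ws x = \prod_(z <- ws) z.
Proof.
move=> us sz; have wsE : ws = map (list_weight s ws) s.
  apply: (@eq_from_nth _ 1); rewrite ?size_map // sz => i si.
  case: s si us sz => // x0 s si us sz.
  by rewrite (nth_map x0) // list_weight_nth.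
rewrite [in RHS]wsE big_map (big_uniq _ us) /= [RHS]big_mkcond; apply: eq_bigr => x _.
by case: ifPn => // xs; rewrite list_weight_notin.
Qed.

(** * The two graphs *)

Lemma wload_two_edges (R : realType) (k : nat) (mu : R)
    (w : two_edges k -> R) (v : two_edges k) :
  (0 < k)%N -> 0 <= mu -> (forall x, 0 < w x) ->
  \prod_(x < k) w (inl x) = mu ^+ k -> \prod_(x < k) w (inr x) = mu ^+ k ->
  wload k w v = mu.
Proof.
move=> k0 mu0 w0 wl wr; rewrite /wload /load.
pose E1 : {set two_edges k} := [set inl x | x in [set: 'I_k]].
pose E2 : {set two_edges k} := [set inr x | x in [set: 'I_k]].
have P1 : edge_weight (fun u => kroot k (w u)) E1 = mu.
  apply: prod_kroot => //; rewrite big_imset /= => [|x y _ _ []] //.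
  by rewrite -wl; apply: eq_bigl => x; rewrite inE.
have P2 : edge_weight (fun u => kroot k (w u)) E2 = mu.
  apply: prod_kroot => //; rewrite big_imset /= => [|x y _ _ []] //.
  by rewrite -wr; apply: eq_bigl => x; rewrite inE.
case: v => x.
  rewrite (big_pred1 E1) // => e /=; rewrite in_set2 -/E1 -/E2.
  have xE1 : (inl x : two_edges k) \in E1 by rewrite imset_f.
  have xE2 : (inl x : two_edges k) \notin E2 by apply/imsetP => -[].
  by do 2?case: eqP => [->|_] /=; rewrite ?xE1 ?(negbTE xE2).
rewrite (big_pred1 E2) // => e /=; rewrite in_set2 -/E1 -/E2.
have xE1 : (inr x : two_edges k) \notin E1 by apply/imsetP => -[].
have xE2 : (inr x : two_edges k) \in E2 by rewrite imset_f.
by do 2?case: eqP => [->|_] /=; rewrite ?xE2 ?(negbTE xE1).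
Qed.

Lemma wload_one_edge (R : realType) (k : nat) (mu : R)
    (w : one_edge k -> R) (v : one_edge k) :
  (0 < k)%N -> 0 <= mu -> (forall x, 0 < w x) ->
  \prod_(x < k) w x = mu ^+ k -> wload k w v = mu.
Proof.
move=> k0 mu0 w0 wE; rewrite /wload /load (big_pred1 [set: 'I_k]); last first.
  by move=> e /=; rewrite finset.in_set1; case: eqP => [->|]; rewrite ?inE.
by apply: prod_kroot => //; rewrite -wE; apply: eq_bigl => x; rewrite inE.
Qed.

Lemma end_weight_ge1 (R : realFieldType) (c : R) n : 0 < c -> 1 <= end_weight c n.
Proof. by move=> c0; rewrite -end_weightE // lerDl ltW ?path_weight_gt0. Qed.

(** Both initial edges carry the three end weights, with product mu^k, so they have z = 1 and all
    initial loads are [mu]. Three joins then keep the inequality needed for the upper bound. *)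
Lemma rho_C2_le (R : realType) (k n1 n2 n3 : nat) (u1 u2 u3 v1 v2 v3 : 'I_k)
    (c mu : R) :
  (2 < k)%N -> 0 < c -> 0 < mu -> mu ^+ k = ((1 + c ^+ 2) / c) ^+ 2 ->
  end_weight c n1 * end_weight c n2 * end_weight c n3 = mu ^+ k ->
  uniq [:: u1; u2; u3] -> uniq [:: v1; v2; v3] ->
  rho R k (C2 u1 u2 u3 v1 v2 v3 n1 n2 n3) <= mu.
Proof.
move=> k2 c0 mu0 muk nk uu uv; have k0 : (0 < k)%N by lia.
pose ws := [:: end_weight c n1; end_weight c n2; end_weight c n3].
pose w0 (v : two_edges k) : R := match v with
  | inl x => list_weight [:: u1; u2; u3] ws x
  | inr x => list_weight [:: v1; v2; v3] ws x end.
have w0_ge1 v : 1 <= w0 v.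
  by case: v => x; apply: (@list_weight_all _ _ _ _ (fun z => 1 <= z)) => //=;
    rewrite !end_weight_ge1.
have w0_gt0 v : 0 < w0 v by apply: lt_le_trans (w0_ge1 v).
have prodw s : uniq s -> size s = 3%N ->
    \prod_(x : 'I_k) list_weight s ws x = mu ^+ k.
  by move=> us ss; rewrite prod_list_weight // !big_cons big_nil mulr1 mulrA.
have l0 v : wload k w0 v = mu.
  by apply: wload_two_edges => //; [exact: ltW | exact: prodw | exact: prodw].
have wu i : (i < 3)%N -> w0 (inl (nth u1 [:: u1; u2; u3] i)) = nth 1 ws i.
  by move=> i3; rewrite /w0 list_weight_nth.
have wv i : (i < 3)%N -> w0 (inr (nth u1 [:: v1; v2; v3] i)) = nth 1 ws i.
  by move=> i3; rewrite /w0 list_weight_nth.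
have [[wu1 wu2 wu3] [wv1 wv2 wv3]] := ((And3 (wu 0%N isT) (wu 1%N isT) (wu 2%N isT)),
  (And3 (wv 0%N isT) (wv 1%N isT) (wv 2%N isT))).
have := uu; rewrite /= !inE !negb_or => /andP[/andP[u12 u13] /andP[u23 _]].
have := uv; rewrite /= !inE !negb_or => /andP[/andP[v12 v13] /andP[v23 _]].
have nu x y z : x != y -> (inl y : two_edges k) \notin [:: inl x; inr z].
  by move=> xy; rewrite !inE negb_or andbT; apply: contraNneq xy => -[->].
have nv x y z : x != y -> (inr y : two_edges k) \notin [:: inl z; inr x].
  by move=> xy; rewrite !inE /=; apply: contraNneq xy => -[->].
have s0 x y := @two_edges_separated k x y.
have l0_le v : wload k w0 v <= mu by rewrite l0.
have [w1 [w1_gt0 w1E w1o w1c]] := join_wload_le k2 c0 mu0 muk (s0 u1 v1) w0_gt0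
  wu1 wv1 (l0_le _) (l0_le _).
pose e1 := join_emb k (inl u1 : two_edges k) (inr v1) n1.
have s1 x y : u1 != x -> v1 != y -> separated (e1 (inl x)) (e1 (inr y)).
  by move=> ux vy; apply: join_emb_separated; [exact: s0 | exact: nu | exact: nv].
have l1 x : x \notin [:: inl u1; inr v1] -> wload k w1 (e1 x) <= mu.
  by move=> /w1o/le_trans; apply.
have [w2 [w2_gt0 w2E w2o w2c]] := join_wload_le k2 c0 mu0 muk (s1 _ _ u12 v12)
  w1_gt0 (etrans (w1E _) wu2) (etrans (w1E _) wv2)
  (l1 _ (nu _ _ _ u12)) (l1 _ (nv _ _ _ v12)).
pose e2 := join_emb k (e1 (inl u2)) (e1 (inr v2)) n2.
have nu1 : e1 (inl u3) \notin [:: e1 (inl u2); e1 (inr v2)].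
  by rewrite !inE negb_or !join_emb_neq ?nu // eq_sym.
have nv1 : e1 (inr v3) \notin [:: e1 (inl u2); e1 (inr v2)].
  by rewrite !inE negb_or !join_emb_neq ?nv // eq_sym.
have s2 : separated (e2 (e1 (inl u3))) (e2 (e1 (inr v3))).
  by apply: join_emb_separated => //; exact: s1.
have l2 x : x \notin [:: inl u1; inr v1] ->
    e1 x \notin [:: e1 (inl u2); e1 (inr v2)] -> wload k w2 (e2 (e1 x)) <= mu.
  by move=> /l1 lx /w2o/le_trans; apply.
have [w3 [w3_gt0 w3E w3o w3c]] := join_wload_le k2 c0 mu0 muk s2
  w2_gt0 (etrans (w2E _) (etrans (w1E _) wu3))
  (etrans (w2E _) (etrans (w1E _) wv3))
  (l2 _ (nu _ _ _ u13) nu1) (l2 _ (nv _ _ _ v13) nv1).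
apply: (rho_le_wload k0 _ (ltW mu0) w3_gt0); first exact: C2_uniform.
(* A vertex not settled by a join comes from the preceding graph, with no larger load. Traced back
   to the initial edges, its load is [mu] and its weight at least 1. *)
move=> v; have [//|[x3 ->]] := w3c v; rewrite w3E => /le_trans; apply.
have [//|[x2 ->]] := w2c x3; rewrite w2E => /le_trans; apply.
have [//|[x1 ->]] := w1c x2; rewrite w1E => /le_trans; apply.
by rewrite l0 ler_peMr // ltW.
Qed.

(** A lower bound needs equality at every vertex; both paths have positive length, and adding such a
    path preserves equality. The initial edge contains both ends of each path, so its weights
    multiply to the square of the assumed product, which is mu^k. *)
Lemma rho_C3_ge (R : realType) (k n1 n2 : nat) (a1 a2 b1 b2 : 'I_k) (c mu : R) :
  (2 < k)%N -> 0 < c -> 0 < mu -> mu ^+ k = ((1 + c ^+ 2) / c) ^+ 2 ->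
  end_weight c n1.+1 * end_weight c n2.+1 = (1 + c ^+ 2) / c ->
  uniq [:: a1; a2; b1; b2] ->
  mu <= rho R k (C3 a1 a2 b1 b2 n1.+1 n2.+1).
Proof.
move=> k2 c0 mu0 muk nk us; have k0 : (0 < k)%N by lia.
pose ws := [:: end_weight c n1.+1; end_weight c n1.+1;
  end_weight c n2.+1; end_weight c n2.+1].
pose w0 : one_edge k -> R := list_weight [:: a1; a2; b1; b2] ws.
have w0_gt0 v : 0 < w0 v.
  by apply: (@list_weight_all _ _ _ _ (fun z => 0 < z)) => //=; rewrite !end_weight_gt0.
have l0 v : wload k w0 v = mu.
  apply: wload_one_edge => //; first exact: ltW.
  rewrite prod_list_weight // !big_cons big_nil muk -nk; ring.
have wi i : (i < 4)%N -> w0 (nth a1 [:: a1; a2; b1; b2] i) = nth 1 ws i.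
  by move=> i3; rewrite /w0 list_weight_nth.
have := us; rewrite /= !inE !negb_or.
move=> /and3P[/and3P[a12 a1b1 a1b2] /andP[a2b1 a2b2] /andP[b12 _]].
have nb x : x \in [:: b1; b2] -> x \notin [:: a1; a2].
  rewrite !inE negb_or => /orP[]/eqP->; rewrite ![_ == a1]eq_sym ![_ == a2]eq_sym.
    by rewrite a1b1.
  by rewrite a1b2.
pose w1 := @path_extension (one_edge k) a1 a2 k n1.+1 R c w0.
have w1_gt0 v : 0 < w1 v by exact: path_extension_gt0.
have l1 x : x \in [:: b1; b2] -> wload k w1 (inl x) = mu.
  by move=> /nb xa; rewrite wload_add_path_old.
pose H1 := add_path k (a1 : one_edge k) a2 n1.+1.
pose x1 : H1 := inl b1; pose x2 : H1 := inl b2.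
have x12 : x1 != x2 by [].
pose w2 := @path_extension H1 x1 x2 k n2.+1 R c w1.
apply: (@rho_ge_wload R k mu k0 (add_path k x1 x2 n2.+1) w2 (inl (inl a1)) _
  (ltW mu0)).
- exact: (C3_uniform (ltn0Sn n1) (ltn0Sn n2) us).
- exact: path_extension_gt0.
move=> v; have := wload_add_path_eq x12 (ltn0Sn n2) k2 c0 mu0 muk w1_gt0
  (wi 2%N isT) (wi 3%N isT) (l1 _ (mem_head _ _)) (l1 _ (mem_last _ [:: b2])) v.
move=> [[x xb ->]|//]; rewrite wload_add_path_old // [w2 _]/=.
have := @wload_add_path_eq (one_edge k) a1 a2 k n1.+1 a12 (ltn0Sn n1) k2 _ _ _ _
  c0 mu0 muk w0_gt0
  (wi 0%N isT) (wi 1%N isT) (l0 _) (l0 _) x.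
move=> [[y ya xy]|//]; rewrite xy wload_add_path_old // l0 /=.
(* Only initial vertices outside both pairs of ends remain; they have weight 1 and load [mu]. *)
rewrite /w0 list_weight_notin ?mulr1 //; apply: contra ya.
move: xb; rewrite xy !inE !negb_or => /andP[yb1 yb2].
rewrite orbA => /orP[//|/orP[]/eqP yb].
- by rewrite yb eqxx in yb1.
- by rewrite yb eqxx in yb2.
Qed.

(** * Comparison of the two spectral radii *)

Unset Implicit Arguments.

Theorem theorem5p3 (R : realType) (k p q : nat)
    (u1 u2 u3 v1 v2 v3 : 'I_k) (a1 a2 b1 b2 : 'I_k) :
  (4 <= k)%N -> (0 < q)%N -> (q <= p)%N -> (p - q <= 1)%N ->
  uniq [:: u1; u2; u3] -> uniq [:: v1; v2; v3] ->
  uniq [:: a1; a2; b1; b2] ->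
  rho R k (C2 u1 u2 u3 v1 v2 v3 (p - 1) (q - 1) 1)
    < rho R k (C3 a1 a2 b1 b2 p q).
Proof.
move=> k4 q0 qp _ uu uv us; have k2 : (2 < k)%N by lia.
have k0 : (0 < k)%N by lia.
(* From here on [p] and [q] are the original values minus 1, as in [end_weight_roots]. *)
case: p q q0 qp => [|p] [|q] // _ _; rewrite !subSS !subn0.
have [c [d [c0 cd d1 Gc Hd]]] := end_weight_roots R p q.
have d0 := lt_trans c0 cd.
pose s (x : R) := (1 + x ^+ 2) / x.
have s0 x : 0 < x -> 0 < s x by move=> x0; rewrite divr_gt0 // addr_gt0 ?exprn_gt0.
pose mu x := kroot k (s x ^+ 2).
have mu0 x : 0 < x -> 0 < mu x by move=> x0; rewrite kroot_gt0 // exprn_gt0 ?s0.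
have muk x : 0 < x -> mu x ^+ k = s x ^+ 2.
  by move=> x0; rewrite krootK // exprn_gt0 ?s0.
apply: (@le_lt_trans _ _ (mu d)).
  by apply: (@rho_C2_le _ _ _ _ _ _ _ _ _ _ _ d) => //; rewrite ?mu0 ?muk.
apply: (@lt_le_trans _ _ (mu c)); last first.
  by apply: (@rho_C3_ge _ _ _ _ _ _ _ _ c) => //; rewrite ?mu0 ?muk.
(* Taking k-th powers and then square roots reduces the claim to s(d) < s(c), which holds since 0 <
   c < d < 1. *)
rewrite -(@ltr_pXn2r _ k) ?nnegrE ?ltW ?mu0 // !muk //.
rewrite ltr_pXn2r ?nnegrE ?ltW ?s0 // /s ltr_pdivrMr // mulrAC ltr_pdivlMr //.
rewrite -subr_gt0 (_ : _ - _ = (d - c) * (1 - c * d)); last ring.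
by rewrite mulr_gt0 ?subr_gt0 // mulr_ilt1 // ?ltW // (lt_trans cd).
Qed.
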